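(* Consider, for $n\to\infty$, uniformly random undirected hypergraphs with $n$ vertices and degree sequences $((d_v)_{v\in V},(\delta_e)_{e\in E})$ (depending on $n$), and let $M_n$ be the number of multi-hyperedge pairs. Suppose $\delta_e=\delta$ for all $e\in E$, with $\delta\in O(1)$, and 1. $\mathbb{E}[d_U^{2\delta}] \in o(n)$; 2. there exists $c > 0$ such that $\lim_{n \to \infty} \mathbb{P}(d_U \geq 2 \delta) \geq c$. Then $$\mathbb{E}[M_n] = \frac{(\delta-1)!}{2\delta}\, (n \mathbb{E}[d_U])^2 \left(\frac{\mathbb{E}[d_U^2] - \mathbb{E}[d_U]}{n\,\mathbb{E}[d_U]^2}\right)^{\delta} (1+o(1)).$$
   Context: All asymptotics are as $n=|V|\to\infty$, along a sequence of degree sequences. Let $V$ be a finite vertex set with $n=|V|$ and $E$ a finite set of (labelled) hyperedges. An undirected degree sequence consists of vertex degrees $d_v\in\mathbb{N}$ ($v\in V$) and hyperedge degrees $\delta_e\in\mathbb{N}$ ($e\in E$) with $\sum_{v}d_v=\sum_e\delta_e$. A uniformly random (stub-labeled) undirected hypergraph with this degree sequence is obtained as follows: each vertex $v$ has $d_v$ distinguishable stubs, and all stubs are distributed over the hyperedges so that each hyperedge $e$ receives exactly $\delta_e$ stubs (as a set: the slots within a hyperedge are interchangeable); every such assignment is equally likely. Each hyperedge $e$ is then a multiset of vertices in which $v$ has multiplicity $m_v(e)$ equal to the number of stubs of $v$ assigned to $e$. Two distinct hyperedges $e_1,e_2\in E$ form a multi-hyperedge pair if they are equal as multisets of vertices;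 $M_n$ is the number of unordered multi-hyperedge pairs. $U$ is a uniformly chosen vertex of $V$, and $d_U$ its degree. *)

(* Defs.v *)
From HB Require Import structures.
From mathcomp Require Import all_boot all_order all_algebra reals.
Set Implicit Arguments.
Unset Strict Implicit.
Unset Printing Implicit Defensive.
Import Order.TTheory GRing.Theory Num.Theory.
Local Open Scope ring_scope.

Record degseq := DegSeq {
  vert : finType;
  hedge : finType;
  vdeg : vert -> nat;
  hdeg : hedge -> nat;
  degseq_sum : (\sum_(v : vert) vdeg v = \sum_(e : hedge) hdeg e)%N
}.

Section Uniform.
Variables (R : realType) (T : finType).

(* Expectation of X and probability of B under the uniform distribution on the
   finite set A; both are 0 when A is empty. *)
Definition unifE (A : {set T}) (X : T -> R) : R :=
  (\sum_(w in A) X w) / #|A|%:R.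

Definition unifP (A B : {set T}) : R := #|A :&: B|%:R / #|A|%:R.

End Uniform.

Section Hypergraph.
Variable D : degseq.

Definition nvert : nat := #|vert D|.

(* The pair (v, i) with i < d_v is the i-th stub of the vertex v. *)
Definition stub : finType := {v : vert D & 'I_(vdeg v)}.

(* A stub-labelled hypergraph is the map sending each stub to its hyperedge, so
   that slots within a hyperedge carry no order. *)
Definition hypergraphs : {set {ffun stub -> hedge D}} :=
  [set H : {ffun stub -> hedge D} |
    [forall e, #|[set s | H s == e]| == hdeg e]].

(* The hyperedge e as a multiset of vertices: v |-> m_v(e). *)
Definition hyperedge (H : {ffun stub -> hedge D}) (e : hedge D) :
    {ffun vert D -> nat} :=
  [ffun v => #|[set i : 'I_(vdeg v) |
                 H (Tagged (fun u => 'I_(vdeg u)) i) == e]|].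

(* Unordered pairs are two-element subsets of the set of hyperedges. *)
Definition multi_hyperedges (H : {ffun stub -> hedge D}) :
    {set {set hedge D}} :=
  [set [set p.1; p.2] | p : hedge D * hedge D
    & (p.1 != p.2) && (hyperedge H p.1 == hyperedge H p.2)].

Section Random.
Variable R : realType.

Definition expected_multi_hyperedges : R :=
  unifE hypergraphs (fun H => #|multi_hyperedges H|%:R).

(* E[d_U ^ j], for U uniform on the vertices. *)
Definition degE (j : nat) : R :=
  unifE [set: vert D] (fun v => (vdeg v)%:R ^+ j).

(* P(d_U >= t), for U uniform on the vertices. *)
Definition degP_ge (t : nat) : R :=
  unifP R [set: vert D] [set v | (t <= vdeg v)%N].

End Random.
End Hypergraph.

(* Main.v *)
Require Import Defs.
From mathcomp Require Import all_boot all_order all_algebra.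
From mathcomp Require Import fingroup perm action primitive_action alt.
From mathcomp Require Import all_classical all_reals all_analysis.
From mathcomp Require Import ring lra zify.
Import Order.TTheory GRing.Theory Num.Theory.
Import numFieldNormedType.Exports.

(** The hyperedges e and f of a uniform stub-labelled hypergraph receive two
    disjoint delta-sets of stubs, and the pair is uniform among all such pairs:
    relabelling the N stubs by a permutation preserves the set of hypergraphs,
    and the symmetric group is transitive on injective tuples of stubs.  Hence
    the probability that e and f are equal as multisets of vertices is
    W / N^_(2 delta), where W counts the injective 2 delta-tuples of stubs whose
    two halves run over the same vertices with the same multiplicities
    ([card_twin_hypergraphs]).  As there are m = N / delta hyperedges,
    E[M_n] = m (m - 1) / 2 * W / N^_(2 delta), exactly.

    To estimate W, match each stub of the second half with a stub of the first
    half at the same vertex.  The matching is one of delta! permutations, and the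
    matched stubs form delta elements of the set of ordered pairs of distinct
    stubs at a common vertex, of cardinal S = \sum_v d_v (d_v - 1).  So
    W <= delta! S^delta ([card_coincident_tuples_le]).  Conversely, delta pairs
    at distinct vertices and a permutation determine a tuple counted by W and are
    determined by it.  If no vertex carries more than M of the S pairs, the
    pairs can be chosen one after the other, which gives
    W >= delta! \prod_(i < delta) (S - i M) ([card_coincident_tuples_ge]).
    Substituting delta! S^delta for W, N^(2 delta) for N^_(2 delta) and N for
    N - delta gives the announced main term, since n E[d_U] = N and
    n (E[d_U^2] - E[d_U]) = S.

    The relative error is controlled by u = 2 delta / N and
    w = (delta - 1) M / S ([multi_hyperedge_ratio_bounds]).  A positive
    proportion of the vertices have degree at least 2 delta >= 2, so N and S are
    both of order at least n, and u tends to 0.  When delta >= 2,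
    M^2 <= \sum_v d_v^4 <= n E[d_U^(2 delta)] = o(n^2), so w tends to 0; when
    delta = 1, w vanishes ([max_pairs_at_sqr_le]). *)

(** * Counting tuples *)

Section Tuples.
Import fintype.
Local Open Scope nat_scope.
Set Implicit Arguments.
Unset Strict Implicit.
Unset Printing Implicit Defensive.

(** The image of a fixed injective tuple under a uniform permutation is uniform
    among injective tuples: the symmetric group is transitive on them, so every
    fibre of s |-> s(t0) is a coset of the stabiliser of t0. *)
Lemma card_perm_tuple (T : finType) (m : nat) (t0 : m.-tuple T)
    (P : pred (m.-tuple T)) : uniq t0 ->
  #|[set s : {perm T} | P (map_tuple s t0)]| * #|T| ^_ m =
  (#|T|)`! * #|[set t : m.-tuple T | uniq t & P t]|.
Proof.
move=> Ut0.
pose act : {action {perm T} &-> m.-tuple T} := n_act_action (perm_action T) m.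
pose U := m.-dtuple([set: T])%g.
have Ut t : (t \in U) = uniq t.
  by rewrite inE; case: (uniq t) => //=; apply/subsetP => x _; rewrite inE.
have le_m : m <= #|T| by rewrite -(size_tuple t0) -(card_uniqP Ut0) max_card.
have trU : [transitive 'Sym_T, on U | act]%g.
  exact: ntransitive_weak le_m (Sym_trans T).
have t0U : t0 \in U by rewrite Ut.
have orbE := atransP trU _ t0U.
have cardU : #|U| = #|T| ^_ m.
  rewrite -[RHS](card_uniq_tuples m predT); apply: eq_card => t.
  by rewrite Ut inE all_predT.
have cardS := card_orbit_stab act ('Sym_T)%G t0.
have cardT : #|('Sym_T)%g| = (#|T|)`! by rewrite card_Sym.
pose c := #|('C_('Sym_T)[t0 | act])%g|.
have fibre t : t \in U -> #|[set s : {perm T} | map_tuple s t0 == t]| = c.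
  rewrite -orbE => /imsetP[a Sa ->];
  transitivity #|amove act ('Sym_T)%G t0 (act t0 a)|.
    by apply: eq_card => s; rewrite !inE.
  by rewrite amove_act // card_rcoset.
have -> : #|[set s : {perm T} | P (map_tuple s t0)]| =
    #|[set t : m.-tuple T | uniq t & P t]| * c.
  rewrite -sum1_card.
  rewrite (partition_big (fun s : {perm T} => map_tuple s t0)
             (mem [set t : m.-tuple T | uniq t & P t])) /=; last first.
    by move=> s; rewrite !inE => ->; rewrite map_inj_uniq ?Ut0 //;
      apply: perm_inj.
  rewrite -sum_nat_const; apply: eq_bigr => t; rewrite inE => /andP[ut Pt].
  rewrite -(fibre t) ?Ut // -sum1_card; apply: eq_bigl => s; rewrite !inE.
  by apply/andP/idP => [[]//|/eqP st]; rewrite st Pt eqxx.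
by rewrite -cardT -cardS orbE cardU -/c mulnC -mulnA (mulnC c).
Qed.

Lemma card_tupleS (T : finType) (k : nat) (P : pred (seq T)) :
  #|[set t : k.+1.-tuple T | P t]| =
  \sum_(t : k.-tuple T) #|[set x | P (x :: t)]|.
Proof.
under [RHS]eq_bigr do rewrite -sum1_card.
under [RHS]eq_bigr => t _ do under eq_bigl do rewrite inE.
rewrite pair_big_dep /= -sum1_card.
rewrite (reindex (fun p : k.-tuple T * T => [tuple of p.2 :: p.1])) /=.
  by apply: eq_bigl => -[t x]; rewrite inE.
exists (fun t : k.+1.-tuple T => ([tuple of behead t], thead t)) => [[t x] _|t _] /=.
  by rewrite theadE; congr (_, _); apply: val_inj.
by rewrite -tuple_eta.
Qed.

Lemma card_tuples_on (T : finType) (A : {set T}) (k : nat) :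
  #|[set t : k.-tuple T | all [in A] t]| = #|A| ^ k.
Proof.
elim: k => [|k IHk].
  by rewrite expn0 (@eq_card1 _ [tuple]) // => t; rewrite [t]tuple0 !inE.
rewrite card_tupleS expnSr -IHk -sum_nat_const [RHS]big_mkcond /=.
apply: eq_bigr => t _; rewrite inE; case: ifP => At.
  by apply: eq_card => x; rewrite inE andbT.
by apply: eq_card0 => x; rewrite inE andbF.
Qed.

(** Greedy choice: once i entries are chosen, at most i * M elements of A share
    their f-value with one of them. *)
Lemma card_tuples_distinct_image (T : finType) (V : eqType) (f : T -> V)
    (A : {set T}) (M k : nat) :
    (forall v, #|[set x in A | f x == v]| <= M) ->
  \prod_(i < k) (#|A| - i * M) <=
  #|[set t : k.-tuple T | all [in A] t & uniq (map f t)]|.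
Proof.
move=> leM; elim: k => [|k IHk].
  by rewrite big_ord0 card_gt0; apply/set0Pn; exists [tuple]; rewrite inE.
rewrite big_ord_recr /= (card_tupleS _ (fun t => all [in A] t && uniq (map f t))).
rewrite (leq_trans (leq_mul IHk (leqnn _))) //.
rewrite -sum_nat_const [leqLHS]big_mkcond leq_sum // => t _.
rewrite inE; case: ifP => // /andP[At Ut].
have hit : #|[set x in A | f x \in map f t]| <= k * M.
  rewrite -{2}(size_tuple t); elim: (t : seq T) => [|y s IHs] /=.
    by rewrite eq_card0 // => x; rewrite !inE andbF.
  apply: leq_trans (leq_add (leM (f y)) IHs); apply: leq_trans (leq_card_setU _ _).
  by apply/subset_leq_card/subsetP=> x; rewrite !inE -andb_orr.
apply: leq_trans (leq_sub2l _ hit) _.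
rewrite leq_subLR -(cardsID [set x | f x \in map f t] A) leq_add //.
  by apply/subset_leq_card/subsetP=> x; rewrite !inE.
by apply/subset_leq_card/subsetP=> x; rewrite !inE /= At Ut andbT => /andP[-> ->].
Qed.

Lemma take_tupleE (T : Type) (k l : nat) (t : (k + l).-tuple T) :
  take k t = [tuple tnth t (lshift l i) | i < k].
Proof.
case: k t => [|k] t; first by rewrite take0 (size0nil (size_tuple _)).
have x0 := thead t; apply: (@eq_from_nth _ x0) => [|i].
  by rewrite size_takel size_tuple ?leq_addr.
rewrite size_takel ?size_tuple ?leq_addr // => lt_ik.
rewrite nth_take // -[i in RHS]/(val (Ordinal lt_ik)).
by rewrite -tnth_nth tnth_mktuple (tnth_nth x0).
Qed.

Lemma drop_tupleE (T : Type) (k l : nat) (t : (k + l).-tuple T) :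
  drop k t = [tuple tnth t (rshift k i) | i < l].
Proof.
case: l t => [|l] t.
  by rewrite drop_oversize ?size_tuple ?addn0 // [RHS](size0nil (size_tuple _)).
have x0 := tnth t (rshift k ord0); apply: (@eq_from_nth _ x0) => [|i].
  by rewrite size_drop !size_tuple addKn.
rewrite size_drop size_tuple addKn => lt_il.
rewrite nth_drop -[i in RHS]/(val (Ordinal lt_il)).
by rewrite -tnth_nth tnth_mktuple (tnth_nth x0).
Qed.

Definition coincident_pairs (T : finType) (V : eqType) (f : T -> V) :
    {set T * T} :=
  [set p | p.1 != p.2 & f p.1 == f p.2].

(** The two halves of such a tuple stand for the stub sets of two hyperedges, and
    [perm_eq] of their images for the equality of the two multisets of vertices. *)
Definition coincident_tuples (T : finType) (V : eqType) (f : T -> V) (k : nat) :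
    {set (k + k).-tuple T} :=
  [set t : (k + k).-tuple T |
     uniq t & perm_eq (map f (take k t)) (map f (drop k t))].

(** Equality of multisets is the existence of a matching between the two halves;
    the permutation is what the two counting bounds below range over. *)
Lemma coincident_tuplesP (T : finType) (V : eqType) (f : T -> V) (k : nat)
    (t : (k + k).-tuple T) :
  reflect (uniq t /\ exists pi : 'S_k, forall i,
             f (tnth t (rshift k i)) = f (tnth t (lshift k (pi i))))
          (t \in coincident_tuples f k).
Proof.
rewrite inE take_tupleE drop_tupleE perm_sym.
rewrite -[map f _]/(tval (map_tuple f _)) -[X in perm_eq _ X]/(tval (map_tuple f _)).
apply: (iffP andP) => -[Ut].
  case/tuple_permP => pi /val_inj eq_pi; split=> //; exists pi => i.
  have /(congr1 (fun s => tnth s i)) /= := eq_pi.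
  by rewrite !(tnth_map, tnth_mktuple).
case=> pi eq_pi; split=> //; apply/tuple_permP; exists pi; congr tval.
by apply: eq_from_tnth => i; rewrite !(tnth_map, tnth_mktuple).
Qed.

Lemma leq_card_bigcup (I T : finType) (F : I -> {set T}) :
  #|\bigcup_i F i| <= \sum_i #|F i|.
Proof.
elim/big_rec2: _ => [|i m U _ leUm]; first by rewrite cards0.
by apply: leq_trans (leq_card_setU _ _) _; rewrite leq_add2l.
Qed.

(** Union bound over the matching pi.  Once pi is fixed, the tuple is recovered
    from the k pairs of matched entries, which are coincident pairs. *)
Lemma card_coincident_tuples_le (T : finType) (V : eqType) (f : T -> V)
    (k : nat) :
  #|coincident_tuples f k| <= k`! * #|coincident_pairs f| ^ k.
Proof.
pose code (pi : 'S_k) (t : (k + k).-tuple T) : k.-tuple (T * T) :=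
  [tuple (tnth t (lshift k (pi i)), tnth t (rshift k i)) | i < k].
pose coded pi :=
  [set t in coincident_tuples f k | all [in coincident_pairs f] (code pi t)].
have le_coded pi : #|coded pi| <= #|coincident_pairs f| ^ k.
  rewrite -card_tuples_on -(@card_in_imset _ _ (code pi)).
    by apply/subset_leq_card/subsetP=> _ /imsetP[t /[!inE] /andP[_ ?] ->].
  move=> t u _ _ eq_tu; apply: eq_from_tnth => i.
  have tu j : tnth (code pi t) j = tnth (code pi u) j by rewrite eq_tu.
  case: (split_ordP i) => j ->; last by have := tu j; rewrite !tnth_mktuple => -[].
  by have := tu (pi^-1 j)%g; rewrite !tnth_mktuple permKV => -[].
have cover t : t \in coincident_tuples f k -> exists pi, t \in coded pi.
  move=> Wt; case/coincident_tuplesP: (Wt) => Ut [pi eq_pi]; exists pi.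
  rewrite inE Wt; apply/all_tnthP => i.
  by rewrite tnth_mktuple inE /= eq_pi eqxx (inj_eq (tuple_uniqP _ Ut)) eq_lrshift.
apply: leq_trans (_ : #|\bigcup_(pi : 'S_k) coded pi| <= _).
  by apply/subset_leq_card/subsetP=> t /cover[pi pi_t]; apply/bigcupP; exists pi.
apply: leq_trans (leq_card_bigcup _) _.
have -> : k`! = #|[set: 'S_k]| by rewrite cardsT card_Sn.
by rewrite -sum_nat_const [leqRHS]big_mkcond leq_sum // => pi _; rewrite inE.
Qed.

(** Pairs with distinct f-values, listed in the order of the first half, and a
    permutation pi for the second half give a coincident tuple.  This is injective:
    as the f-values are distinct, pi can be read off from the tuple. *)
Lemma card_coincident_tuples_ge (T : finType) (V : eqType) (f : T -> V)
    (M k : nat) :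
    (forall v, #|[set p in coincident_pairs f | f p.1 == v]| <= M) ->
  k`! * \prod_(i < k) (#|coincident_pairs f| - i * M) <=
  #|coincident_tuples f k|.
Proof.
move=> leM; set X := coincident_pairs f.
pose g (p : T * T) := f p.1.
set Y := [set t : k.-tuple (T * T) | all [in X] t & uniq (map g t)].
have leY : \prod_(i < k) (#|X| - i * M) <= #|Y| by apply: card_tuples_distinct_image.
apply: leq_trans (leq_mul (leqnn _) leY) _.
have -> : k`! = #|[set: 'S_k]| by rewrite cardsT card_Sn.
rewrite -cardsX.
pose join (c : 'S_k * k.-tuple (T * T)) : (k + k).-tuple T :=
  [tuple of [tuple (tnth c.2 i).1 | i < k] ++ [tuple (tnth c.2 (c.1 i)).2 | i < k]].
have joinl c i : tnth (join c) (lshift k i) = (tnth c.2 i).1.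
  by rewrite tnth_lshift tnth_mktuple.
have joinr c i : tnth (join c) (rshift k i) = (tnth c.2 (c.1 i)).2.
  by rewrite tnth_rshift tnth_mktuple.
have inY p : p \in Y -> [/\ forall i, (tnth p i).1 != (tnth p i).2,
    forall i, f (tnth p i).2 = g (tnth p i) & injective (fun i => g (tnth p i))].
  rewrite inE => /andP[/all_tnthP Xp] /(tuple_uniqP (map_tuple g p)) injp.
  split=> [i|i|i j eq_ij]; try by have := Xp i; rewrite inE => /andP[? /eqP].
  by apply: injp; rewrite !tnth_map.
rewrite -(@card_in_imset _ _ join).
  apply/subset_leq_card/subsetP=> _ /imsetP[[pi p] /setXP[_ /inY[neq eqf injp]] ->].
  apply/coincident_tuplesP; split; last first.
    by exists pi => i; rewrite joinl joinr eqf.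
  apply/tuple_uniqP => i j.
  case: (split_ordP i) => i' ->; case: (split_ordP j) => j' ->;
    rewrite ?joinl ?joinr /= => eq_ij.
  - by congr lshift; apply/injp/(congr1 f).
  - have /injp eq_i : g (tnth p i') = g (tnth p (pi j')) by rewrite -[RHS]eqf -eq_ij.
    by have := neq i'; rewrite eq_ij eq_i eqxx.
  - have /injp eq_j : g (tnth p (pi i')) = g (tnth p j') by rewrite -eqf eq_ij.
    by have := neq j'; rewrite -eq_ij eq_j eqxx.
  - by congr rshift; apply/(@perm_inj _ pi)/injp; rewrite -!eqf eq_ij.
move=> [pi p] [rho q] /setXP[_ /inY[_ eqfp injp]] /setXP[_ /inY[_ eqfq _]] eq_pq.
have eq1 i : (tnth p i).1 = (tnth q i).1 by rewrite -(joinl (pi, p)) eq_pq joinl.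
have eq2 i : (tnth p (pi i)).2 = (tnth q (rho i)).2.
  by rewrite -(joinr (pi, p)) eq_pq joinr.
have eq_pi : pi = rho.
  by apply/permP => i; apply: injp; rewrite -eqfp eq2 eqfq /g eq1.
congr (_, _) => //; apply: eq_from_tnth => i.
rewrite [LHS]surjective_pairing [RHS]surjective_pairing eq1.
by rewrite -(permKV pi i) eq2 eq_pi.
Qed.

Lemma card_offdiag (T : finType) (A : {set T}) :
  #|[set p : T * T | [&& p.1 \in A, p.2 \in A & p.1 != p.2]]| = #|A| * #|A|.-1.
Proof.
transitivity #|finset.setX A A :\: [set (x, x) | x in A]|.
  apply: eq_card => -[x y]; rewrite !inE /=.
  have -> : ((x, y) \in [set (z, z) | z in A]) = (x \in A) && (x == y).
    by apply/imsetP/andP => [[z Az [-> ->]]|[Ax /eqP<-]]; [|exists x].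
  by case: (x \in A) => //=; rewrite andbC.
rewrite cardsDS; last by apply/subsetP => _ /imsetP[x Ax ->]; rewrite inE /= Ax.
rewrite cardsX card_imset => [|x y []//].
by rewrite -{3}[#|A|]muln1 -mulnBr subn1.
Qed.

Lemma card_tag_fibre (I : finType) (T_ : I -> finType) (i : I) :
  #|[set x : {j : I & T_ j} | tag x == i]| = #|T_ i|.
Proof.
rewrite -(@card_imset _ _ (@Tagged _ i T_)) => [|x y /eqP]; last first.
  by rewrite eq_Tagged => /eqP.
apply: eq_card => x; rewrite inE; apply/eqP/imsetP => [|[y _ ->]//].
by case: x => j y /= eq_j; move: y; rewrite eq_j => y; exists y.
Qed.

Lemma leq_expn_ffact n m : (n - m) ^ m <= n ^_ m.
Proof.
elim: m => [|m IHm]; first by rewrite ffactn0.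
rewrite ffactnSr expnSr leq_mul ?leq_sub2l // (leq_trans _ IHm) //.
by case: m {IHm} => // m; rewrite leq_exp2r ?leq_sub2l.
Qed.

Lemma leq_ffact_expn n m : n ^_ m <= n ^ m.
Proof.
elim: m => [|m IHm]; first by rewrite ffactn0.
by rewrite ffactnSr expnSr leq_mul ?leq_subr.
Qed.

End Tuples.

(** * Coincident hyperedges *)

Section Hypergraphs.
Import fintype.
Local Open Scope nat_scope.
Set Implicit Arguments.
Unset Strict Implicit.
Unset Printing Implicit Defensive.
Variable D : degseq.
Implicit Types (H : {ffun stub D -> hedge D}) (e : hedge D) (s : {perm stub D}).

Definition stubs_in H e : {set stub D} := [set x | H x == e].

Definition vertex_of (x : stub D) : vert D := tag x.

Lemma hyperedgeE H e v :
  hyperedge H e v = count_mem v (map vertex_of (enum (stubs_in H e))).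
Proof.
rewrite ffunE count_map -size_filter.
rewrite -(@card_in_imset _ _ (@Tagged _ v (fun u => 'I_(vdeg u)))); last first.
  by move=> i j _ _ /eqP; rewrite eq_Tagged => /eqP.
rewrite cardE; apply/perm_size/uniq_perm;
  [exact: enum_uniq | exact/filter_uniq/enum_uniq |].
move=> x; rewrite mem_enum [RHS]mem_filter mem_enum /= inE; apply/imsetP/andP => [[i]|[]].
  by rewrite inE => Hi ->; rewrite Hi eqxx.
by case: x => u i /= /eqP eq_u; move: i; rewrite eq_u => i Hi; exists i; rewrite ?inE.
Qed.

Lemma eq_hyperedge H e1 e2 :
  (hyperedge H e1 == hyperedge H e2) =
  perm_eq (map vertex_of (enum (stubs_in H e1)))
          (map vertex_of (enum (stubs_in H e2))).
Proof.
apply/eqP/idP => [eq_h|/seq.permP eq_c].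
  by apply/allP => v _ /=; rewrite -!hyperedgeE eq_h.
by apply/ffunP => v; rewrite !hyperedgeE eq_c.
Qed.

Definition relabel s H : {ffun stub D -> hedge D} := [ffun x => H (s x)].

Lemma relabelK s : cancel (relabel s) (relabel s^-1).
Proof. by move=> H; apply/ffunP => x; rewrite !ffunE permKV. Qed.

Lemma stubs_in_relabel s H e : stubs_in (relabel s H) e = s @^-1: stubs_in H e.
Proof. by apply/setP => x; rewrite !inE ffunE. Qed.

Lemma relabel_hypergraphs s H : (relabel s H \in hypergraphs D) = (H \in hypergraphs D).
Proof.
rewrite !inE; apply: eq_forallb => e; congr (_ == _).
rewrite -/(stubs_in _ e) stubs_in_relabel on_card_preimset //.
by apply: onW_bij; exists s^-1%g => x; rewrite ?permK ?permKV.
Qed.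

Lemma map_enum_preim s (A : {set stub D}) :
  perm_eq (enum (s @^-1: A)) (map s^-1%g (enum A)).
Proof.
apply: uniq_perm; rewrite ?(map_inj_uniq perm_inj) ?enum_uniq // => x.
rewrite mem_enum inE -{2}(permK s x) mem_map ?mem_enum //.
exact: perm_inj.
Qed.

Definition twin_hypergraphs e1 e2 : {set {ffun stub D -> hedge D}} :=
  [set H in hypergraphs D | hyperedge H e1 == hyperedge H e2].

Lemma in_twin_hypergraphs e1 e2 H :
  (H \in twin_hypergraphs e1 e2) =
  (H \in hypergraphs D) && (hyperedge H e1 == hyperedge H e2).
Proof. by rewrite [LHS]inE. Qed.

(** Relabelling by s replaces the stubs of e1 and e2 by their images under the
    inverse of s, and those images run over all pairs of disjoint stub sets. *)
Lemma card_relabel_twins H e1 e2 k :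
    e1 != e2 -> hdeg e1 = k -> hdeg e2 = k -> H \in hypergraphs D ->
  #|[set s | relabel s H \in twin_hypergraphs e1 e2]| * #|stub D| ^_ (k + k) =
  (#|stub D|)`! * #|coincident_tuples vertex_of k|.
Proof.
move=> neq_e de1 de2 hypH.
have size_in e : hdeg e = k -> size (enum (stubs_in H e)) = k.
  by move=> <-; rewrite -cardE; move: hypH; rewrite inE => /forallP/(_ e)/eqP.
have size_t : size (enum (stubs_in H e1) ++ enum (stubs_in H e2)) == k + k.
  by rewrite size_cat !size_in.
pose t0 := Tuple size_t.
have Ut0 : uniq t0.
  rewrite cat_uniq !enum_uniq andbT; apply/hasPn => x.
  rewrite !mem_enum !inE => /eqP->; by rewrite eq_sym.
pose P (t : (k + k).-tuple (stub D)) :=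
  perm_eq (map vertex_of (take k t)) (map vertex_of (drop k t)).
rewrite -(card_perm_tuple P Ut0) -(card_imset _ invg_inj); congr (_ * _).
apply: eq_card => s; rewrite -{1}(invgK s) (mem_imset _ _ invg_inj) !inE.
have -> : [forall e, #|[set x | relabel s^-1 H x == e]| == hdeg e].
  by have := relabel_hypergraphs s^-1 H; rewrite hypH inE.
rewrite eq_hyperedge !stubs_in_relabel /P /= map_cat.
rewrite take_size_cat ?size_map ?size_in // drop_size_cat ?size_map ?size_in //.
have pe e := perm_map vertex_of (map_enum_preim s^-1 (stubs_in H e)).
by rewrite (permPl (pe e1)) (permPr (pe e2)) invgK.
Qed.

(** Double count of the pairs (H, s) such that e1 and e2 coincide in
    [relabel s H].  For fixed s, relabelling is a bijection of the hypergraphs; for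
    fixed H, the count is that of [card_relabel_twins], whatever H is. *)
Lemma card_twin_hypergraphs e1 e2 k :
    e1 != e2 -> hdeg e1 = k -> hdeg e2 = k ->
  #|twin_hypergraphs e1 e2| * #|stub D| ^_ (k + k) =
  #|hypergraphs D| * #|coincident_tuples vertex_of k|.
Proof.
move=> neq_e de1 de2; set Tw := twin_hypergraphs e1 e2.
have count_pairs : \sum_(H in hypergraphs D) #|[set s | relabel s H \in Tw]| =
    (#|stub D|)`! * #|Tw|.
  under eq_bigr do rewrite -sum1_card big_mkcond.
  rewrite exchange_big /= (eq_bigr (fun=> #|Tw|)) => [|s _].
    by rewrite sum_nat_const -(card_Sym (stub D)) cardsT.
  rewrite -(@on_card_preimset _ _ (relabel s)).
    rewrite -sum1_card [RHS]big_mkcond [LHS]big_mkcond; apply: eq_bigr => H _.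
    have -> : (H \in relabel s @^-1: Tw) = (relabel s H \in Tw) by rewrite [LHS]inE.
    rewrite [s \in _]inE /Tw in_twin_hypergraphs relabel_hypergraphs.
    by case: (H \in _).
  apply: onW_bij; exists (relabel s^-1); first exact: relabelK.
  by move=> H; have := relabelK s^-1 H; rewrite invgK.
apply/eqP; rewrite -(eqn_pmul2l (fact_gt0 #|stub D|)) mulnA -count_pairs.
rewrite big_distrl /= (eq_bigr _ (fun H => card_relabel_twins neq_e de1 de2)).
by rewrite sum_nat_const mulnCA.
Qed.

Lemma card_stubs_of v : #|[set x | vertex_of x == v]| = vdeg v.
Proof. by rewrite card_tag_fibre card_ord. Qed.

Lemma card_stub : #|stub D| = \sum_(v : vert D) vdeg v.
Proof.
rewrite -sum1_card (partition_big vertex_of predT) //=.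
by apply: eq_bigr => v _; rewrite sum1dep_card card_stubs_of.
Qed.

(** The stubs and the slots of the hyperedges are equally many, and any bijection
    between them yields a hypergraph. *)
Lemma hypergraphs_neq0 : 0 < #|hypergraphs D|.
Proof.
pose slot := {e : hedge D & 'I_(hdeg e)}.
have card_slot : #|stub D| = #|{: slot}|.
  rewrite card_stub degseq_sum card_tagged sumnE big_map big_enum /=.
  by under [RHS]eq_bigr do rewrite card_ord.
pose b (x : stub D) : slot := enum_val (cast_ord card_slot (enum_rank x)).
have bij_b : bijective b.
  exists (fun y => enum_val (cast_ord (esym card_slot) (enum_rank y))) => x;
  by rewrite /b enum_valK ?cast_ordK ?cast_ordKV enum_rankK.
rewrite card_gt0; apply/set0Pn; exists [ffun x => tag (b x)].
rewrite inE; apply/forallP => e; apply/eqP.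
transitivity #|b @^-1: [set y : slot | tag y == e]|.
  by apply: eq_card => x; rewrite !inE ffunE.
rewrite on_card_preimset; last exact: onW_bij.
by rewrite card_tag_fibre card_ord.
Qed.

(** Each unordered pair comes from exactly two ordered ones. *)
Lemma card_multi_hyperedges H :
  2 * #|multi_hyperedges H| =
  \sum_(p : hedge D * hedge D | p.1 != p.2) (hyperedge H p.1 == hyperedge H p.2).
Proof.
set Q := [set p : hedge D * hedge D |
            (p.1 != p.2) && (hyperedge H p.1 == hyperedge H p.2)].
pose pr (p : hedge D * hedge D) := [set p.1; p.2].
have -> : multi_hyperedges H = pr @: Q.
  by apply/setP => A; apply/imsetP/imsetP => -[p Qp ->]; exists p; rewrite // inE in Qp *.
transitivity #|Q|; last first.
  rewrite -sum1_card [LHS]big_mkcond [RHS]big_mkcond; apply: eq_bigr => p _.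
  by rewrite inE; case: eqP => //= _; case: eqP.
rewrite -[RHS]sum1_card (partition_big_imset pr) /= mulnC -sum_nat_const.
apply: eq_bigr => _ /imsetP[[e1 e2] /= Qp ->]; rewrite sum1dep_card.
move: (Qp); rewrite inE /= => /andP[neq_e eq_h].
symmetry; transitivity #|[set (e1, e2); (e2, e1)]|; last first.
  by rewrite cards2 xpair_eqE negb_and neq_e.
apply: eq_card => -[f1 f2]; rewrite !inE !xpair_eqE /=.
apply/idP/idP => [|/orP[]/andP[/eqP-> /eqP->]]; last 2 first.
- by rewrite neq_e eq_h eqxx.
- by rewrite eq_sym neq_e eq_sym eq_h /pr /= finset.setUC eqxx.
case/andP => /andP[neq_f _] /eqP eq_pr.
have := set21 f1 f2; rewrite -[[set f1; f2]]/(pr (f1, f2)) eq_pr !inE.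
have := set22 f1 f2; rewrite -[[set f1; f2]]/(pr (f1, f2)) eq_pr !inE.
by case/orP=> /eqP eq2 /orP[]/eqP eq1; move: neq_f; rewrite eq1 eq2 ?eqxx ?orbT.
Qed.

Lemma sum_multi_hyperedges k : (forall e, hdeg e = k) ->
  2 * (\sum_(H in hypergraphs D) #|multi_hyperedges H|) * #|stub D| ^_ (2 * k) =
  #|hedge D| * #|hedge D|.-1 * #|hypergraphs D| * #|coincident_tuples vertex_of k|.
Proof.
have -> : 2 * k = k + k by rewrite mul2n addnn.
move=> dk; rewrite big_distrr (eq_bigr _ (fun H _ => card_multi_hyperedges H)) /=.
rewrite exchange_big big_distrl /=.
rewrite (eq_bigr (fun=> #|hypergraphs D| * #|coincident_tuples vertex_of k|)).
  rewrite sum_nat_const mulnA; congr (_ * _ * _).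
  rewrite -cardsT -card_offdiag; apply: eq_card => -[e f].
  by rewrite !inE.
move=> [e f] /= neq_ef; rewrite -(card_twin_hypergraphs neq_ef (dk e) (dk f)).
congr (_ * _); rewrite -sum1_card big_mkcond [RHS]big_mkcond; apply: eq_bigr => H _.
by rewrite in_twin_hypergraphs; case: (H \in _) => //=; case: eqP.
Qed.

Lemma card_coincident_pairs_at v :
  #|[set p in coincident_pairs vertex_of | vertex_of p.1 == v]| =
  vdeg v * (vdeg v).-1.
Proof.
rewrite -card_stubs_of -card_offdiag; apply: eq_card => -[x y]; rewrite !inE /=.
by case: (vertex_of x =P v) => [->|_]; rewrite ?andbF //= andbT andbC eq_sym.
Qed.

Lemma card_coincident_pairs :
  #|coincident_pairs vertex_of| = \sum_(v : vert D) vdeg v * (vdeg v).-1.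
Proof.
rewrite -sum1_card (partition_big (fun p => vertex_of p.1) predT) //=.
apply: eq_bigr => v _; rewrite -card_coincident_pairs_at sum1dep_card.
by apply: eq_card => p; rewrite !inE.
Qed.

End Hypergraphs.

(** * Non-asymptotic estimates *)

Section Estimates.
Local Open Scope ring_scope.
Set Implicit Arguments.
Unset Strict Implicit.
Unset Printing Implicit Defensive.
Variables (R : realType) (D : degseq).

Definition max_pairs_at : nat := \max_(v : vert D) (vdeg v * (vdeg v).-1)%N.

Lemma nvert_degE j : (0 < nvert D)%N ->
  (nvert D)%:R * degE D R j = (\sum_(v : vert D) vdeg v ^ j)%N%:R.
Proof.
move=> n_gt0; rewrite /degE /unifE cardsT -/(nvert D) mulrC divfK; last first.
  by rewrite pnatr_eq0 -lt0n.
by rewrite natr_sum; apply: eq_big => [v|v _]; rewrite ?inE // natrX.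
Qed.

Lemma nvert_degE1 : (0 < nvert D)%N ->
  (nvert D)%:R * degE D R 1 = #|stub D|%:R.
Proof. by move=> n_gt0; rewrite nvert_degE // card_stub. Qed.

Lemma nvert_degE2 : (0 < nvert D)%N ->
  (nvert D)%:R * (degE D R 2 - degE D R 1) = #|coincident_pairs (@vertex_of D)|%:R.
Proof.
move=> n_gt0; rewrite mulrBr !nvert_degE // card_coincident_pairs.
rewrite !natr_sum -sumrB; apply: eq_bigr => v _.
by case: (vdeg v) => [|d]; rewrite ?subrr // -natrB ?leq_pexp2l //; congr (_%:R); lia.
Qed.

Definition multi_hyperedge_main (k : nat) : R :=
  (k.-1)`!%:R / (2 * k%:R) * ((nvert D)%:R * degE D R 1) ^+ 2
  * ((degE D R 2 - degE D R 1) / ((nvert D)%:R * degE D R 1 ^+ 2)) ^+ k.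

(** The first factor compares N^_(2k) with a power of N; its exponent is one less
    than 2k because the number of pairs of hyperedges is proportional to
    N (N - k), and not to N^2.  The second factor compares the number of
    coincident tuples with its upper bound. *)
Definition multi_hyperedge_ratio (k : nat) : R :=
  #|stub D|%:R ^+ (2 * k).-1 * (#|stub D| - k)%:R / (#|stub D| ^_ (2 * k))%:R
  * (#|coincident_tuples (@vertex_of D) k|%:R
     / (k`!%:R * #|coincident_pairs (@vertex_of D)|%:R ^+ k)).

(** The exact relation between the expectation and its main term; it only remains
    to show that [multi_hyperedge_ratio] tends to 1. *)
Lemma expected_multi_hyperedgesE k :
    (0 < k)%N -> (forall e : hedge D, hdeg e = k) -> (2 * k <= #|stub D|)%N ->
    (0 < #|coincident_pairs (@vertex_of D)|)%N ->
  expected_multi_hyperedges D R =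
  multi_hyperedge_main k * multi_hyperedge_ratio k.
Proof.
move=> k_gt0 dk le_2k S_gt0.
have n_gt0 : (0 < nvert D)%N.
  have [x _] : exists x, x \in [set: stub D]%SET.
    by apply/set0Pn; rewrite -card_gt0 cardsT; apply: leq_trans le_2k; lia.
  by apply/card_gt0P; exists (vertex_of x).
have N_m : #|stub D| = (#|hedge D| * k)%N.
  by rewrite card_stub degseq_sum (eq_bigr _ (fun e _ => dk e)) sum_nat_const.
have ES : (degE D R 2 - degE D R 1) / ((nvert D)%:R * degE D R 1 ^+ 2) =
    #|coincident_pairs (@vertex_of D)|%:R / #|stub D|%:R ^+ 2.
  have n_neq0 : (nvert D)%:R != 0 :> R by rewrite pnatr_eq0 -lt0n.
  have d1_neq0 : degE D R 1 != 0.
    have : (nvert D)%:R * degE D R 1 != 0 by rewrite nvert_degE1 // pnatr_eq0; lia.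
    by rewrite mulf_eq0 negb_or => /andP[].
  by rewrite -nvert_degE1 // -nvert_degE2 //; field; rewrite n_neq0 d1_neq0.
rewrite /multi_hyperedge_main /multi_hyperedge_ratio ES nvert_degE1 //.
rewrite /expected_multi_hyperedges /unifE -natr_sum.
have F_gt0 : (0 < #|stub D| ^_ (2 * k))%N by rewrite ffact_gt0.
move: (hypergraphs_neq0 D) (sum_multi_hyperedges dk) F_gt0.
move: #|hypergraphs D| #|coincident_tuples _ _| (#|stub D| ^_ _) (\sum_(H in _) _)%N.
move=> h W F E h_gt0 eqE F_gt0.
have k_neq0 : k%:R != 0 :> R by rewrite pnatr_eq0 -lt0n.
have S_neq0 : #|coincident_pairs (@vertex_of D)|%:R ^+ k != 0 :> R.
  by rewrite expf_neq0 // pnatr_eq0 -lt0n.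
have N_neq0 : #|stub D|%:R != 0 :> R by rewrite pnatr_eq0; lia.
have h_neq0 : h%:R != 0 :> R by rewrite pnatr_eq0 -lt0n.
have F_neq0 : F%:R != 0 :> R by rewrite pnatr_eq0 -lt0n.
have f_neq0 : (k.-1)`!%:R != 0 :> R by rewrite pnatr_eq0 -lt0n fact_gt0.
have -> : k`! = (k * (k.-1)`!)%N by rewrite -{1}(prednK k_gt0) factS prednK.
have NkE : (#|stub D| - k)%N = (#|hedge D|.-1 * k)%N by rewrite N_m -subn1 mulnBl mul1n.
have NE : #|stub D|%:R ^+ (2 * k) = #|stub D|%:R * #|stub D|%:R ^+ (2 * k).-1 :> R.
  by rewrite -exprS prednK ?muln_gt0.
have P_neq0 : #|stub D|%:R ^+ (2 * k).-1 != 0 :> R by rewrite expf_neq0.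
rewrite expr_div_n -exprM NE NkE; move: S_neq0 P_neq0 N_neq0.
move: (_ ^+ k) (_ ^+ (2 * k).-1) => Q P Q_neq0 P_neq0.
rewrite N_m !natrM => N_neq0.
have EE : E%:R = #|hedge D|%:R * #|hedge D|.-1%:R * h%:R * W%:R / (2 * F%:R) :> R.
  by rewrite -!natrM -eqE !natrM; field.
have m_neq0 : #|hedge D|%:R != 0 :> R by move: N_neq0; rewrite mulf_eq0 negb_or => /andP[].
rewrite EE; field.
by rewrite Q_neq0 P_neq0 k_neq0 h_neq0 F_neq0 f_neq0 m_neq0.
Qed.

Lemma ratio_stubs_bounds (N k : nat) (u := (2 * k)%:R / N%:R : R) :
    (0 < k)%N -> (2 * k < N)%N ->
  1 - u <= N%:R ^+ (2 * k).-1 * (N - k)%:R / (N ^_ (2 * k))%:R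
        <= (1 - u)^-1 ^+ (2 * k).
Proof.
move=> k_gt0 lt_2kN.
have N_gt0 : 0 < N%:R :> R by rewrite ltr0n; lia.
have u_def : u * N%:R = (2 * k)%:R by rewrite divfK // gt_eqF.
have u_lt1 : u < 1 by rewrite ltr_pdivrMr // mul1r ltr_nat.
have NkE : (N - k)%:R = N%:R - k%:R :> R by rewrite natrB //; lia.
have F_gt0 : 0 < (N ^_ (2 * k))%:R :> R by rewrite ltr0n ffact_gt0; lia.
have NE : N%:R ^+ (2 * k) = N%:R * N%:R ^+ (2 * k).-1 :> R.
  by rewrite -exprS prednK ?muln_gt0.
have P_gt0 : 0 < N%:R ^+ (2 * k).-1 :> R by rewrite exprn_gt0.
have le_F : (N ^_ (2 * k))%:R <= N%:R ^+ (2 * k) :> R.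
  by rewrite -natrX ler_nat leq_ffact_expn.
have ge_F : (N%:R * (1 - u)) ^+ (2 * k) <= (N ^_ (2 * k))%:R :> R.
  rewrite mulrBr mulr1 mulrC u_def -natrB; last lia.
  by rewrite -natrX ler_nat leq_expn_ffact.
have k_ge0 : 0 <= k%:R :> R by [].
apply/andP; split.
  rewrite ler_pdivlMr //; apply: le_trans (ler_wpM2l _ le_F) _.
    by rewrite subr_ge0 ltW.
  rewrite NE mulrA [leRHS]mulrC ler_pM2r // mulrBl mul1r u_def NkE natrM; lra.
rewrite ler_pdivrMr // exprVn.
apply: le_trans (ler_wpM2l _ ge_F); last by rewrite invr_ge0 exprn_ge0 ?subr_ge0 ?ltW.
rewrite exprMn mulrCA mulVf ?mulr1 ?expf_neq0 ?subr_eq0 ?gt_eqF // NE mulrC.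
by rewrite ler_pM2r // NkE; lra.
Qed.

(** The factor k - 1 in w, the largest index in the product of
    [card_coincident_tuples_ge], makes both bounds equal to 1 when k = 1. *)
Lemma ratio_coincident_bounds (k : nat)
    (S := #|coincident_pairs (@vertex_of D)|)
    (w := (k.-1 * max_pairs_at)%:R / S%:R : R) :
    (k.-1 * max_pairs_at <= S)%N -> (0 < S)%N ->
  (1 - w) ^+ k <=
  #|coincident_tuples (@vertex_of D) k|%:R / (k`!%:R * S%:R ^+ k : R)
               <= 1.
Proof.
move=> le_MS S_gt0.
have S_gt0' : 0 < S%:R :> R by rewrite ltr0n.
have den_gt0 : 0 < k`!%:R * S%:R ^+ k :> R by rewrite mulr_gt0 ?ltr0n ?fact_gt0 ?exprn_gt0.
rewrite ler_pdivlMr // ler_pdivrMr // mul1r; apply/andP; split; last first.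
  by rewrite -natrX -natrM ler_nat card_coincident_tuples_le.
rewrite mulrCA -exprMn mulrBl mul1r divfK ?gt_eqF // -natrB // -natrX -natrM ler_nat.
apply: leq_trans (card_coincident_tuples_ge k (M := max_pairs_at) _); last first.
  by move=> v; rewrite card_coincident_pairs_at /max_pairs_at (leq_bigmax v).
rewrite leq_mul2l -[X in (_ ^ X)%N](card_ord k) -prod_nat_const leq_prod ?orbT // => i _.
by rewrite leq_sub2l // leq_mul2r; apply/orP; right; have := ltn_ord i; lia.
Qed.

(** The exponents are taken uniform in k <= K, so that the bounds converge along a
    sequence in which k varies but remains bounded. *)
Lemma multi_hyperedge_ratio_bounds (k K : nat)
    (u := (2 * k)%:R / #|stub D|%:R : R)
    (w := (k.-1 * max_pairs_at)%:R / #|coincident_pairs (@vertex_of D)|%:R : R) :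
    (0 < k <= K)%N -> (2 * k < #|stub D|)%N ->
    (k.-1 * max_pairs_at <= #|coincident_pairs (@vertex_of D)|)%N ->
    (0 < #|coincident_pairs (@vertex_of D)|)%N ->
  (1 - u) * (1 - w) ^+ K <= multi_hyperedge_ratio k <= (1 - u)^-1 ^+ (2 * K).
Proof.
move=> /andP[k_gt0 le_kK] lt_2kN le_MS S_gt0.
have /andP[lo1 hi1] := ratio_stubs_bounds k_gt0 lt_2kN.
have /andP[lo2 hi2] := ratio_coincident_bounds le_MS S_gt0.
rewrite -/u in lo1 hi1; rewrite -/w in lo2.
have N_gt0 : 0 < #|stub D|%:R :> R by rewrite ltr0n; lia.
have u_lt1 : u < 1 by rewrite ltr_pdivrMr // mul1r ltr_nat.
have u_ge0 : 0 <= u by rewrite divr_ge0.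
have w_ge0 : 0 <= w by rewrite divr_ge0.
have w_le1 : w <= 1 by rewrite ler_pdivrMr ?ltr0n // mul1r ler_nat.
rewrite /multi_hyperedge_ratio; apply/andP; split.
  apply: ler_pM => //; rewrite ?exprn_ge0 ?subr_ge0 ?(ltW u_lt1) //.
  by apply: le_trans lo2; rewrite ler_wiXn2l ?subr_ge0 // lerBlDr lerDl.
rewrite -[leRHS]mulr1; apply: ler_pM => //.
apply: le_trans hi1 _; rewrite ler_weXn2l ?leq_mul2l // invf_ge1 ?subr_gt0 //.
by rewrite lerBlDr lerDl.
Qed.

Lemma card_large_le_stub t : (0 < t)%N ->
  (#|[set v : vert D | t <= vdeg v]%SET| <= #|stub D|)%N.
Proof.
move=> t_gt0; rewrite card_stub -sum1_card big_mkcond leq_sum // => v _.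
by rewrite inE; case: ifP => // /(leq_trans t_gt0).
Qed.

Lemma card_large_le_pairs t : (1 < t)%N ->
  (#|[set v : vert D | t <= vdeg v]%SET| <= #|coincident_pairs (@vertex_of D)|)%N.
Proof.
move=> t_gt1; rewrite card_coincident_pairs -sum1_card big_mkcond leq_sum // => v _.
by rewrite inE; case: ifP => // /(leq_trans t_gt1); case: (vdeg v) => [|[]].
Qed.

(** For k = 1 the left-hand side is 0.  For k >= 2, a vertex v attaining the
    maximum satisfies (d_v (d_v - 1))^2 <= d_v^4 <= d_v^(2k). *)
Lemma max_pairs_at_sqr_le k : (0 < k)%N ->
  ((k.-1 * max_pairs_at) ^ 2 <= k ^ 2 * \sum_(v : vert D) vdeg v ^ (2 * k))%N.
Proof.
case: k => [|[|k]] // _; rewrite expnMn leq_mul ?leq_exp2r //=.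
have [V0|[v0 _]] := set_0Vmem [set: vert D]%SET.
  rewrite /max_pairs_at big_pred0 // => v.
  by have := finset.in_setT v; rewrite V0 finset.in_set0.
have V_gt0 : (0 < #|vert D|)%N by apply/card_gt0P; exists v0.
have [v eq_v] := bigop.eq_bigmax (fun v : vert D => (vdeg v * (vdeg v).-1)%N)
                   V_gt0.
rewrite /max_pairs_at eq_v (bigD1 v) //= (leq_trans _ (leq_addr _ _)) //.
have [->//|d_gt0] := posnP (vdeg v).
apply: leq_trans (_ : (vdeg v ^ 2) ^ 2 <= _)%N.
  by rewrite leq_exp2r // expnS expn1 leq_mul2l leq_pred orbT.
by rewrite -expnM leq_pexp2l //; lia.
Qed.

End Estimates.

(** * Asymptotics *)

Local Open Scope classical_set_scope.
Local Open Scope ring_scope.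

Theorem lemma2p1 (R : realType) (D : nat -> degseq) (delta : nat -> nat)
  (n_infty : (fun k => nvert (D k)) @ \oo --> \oo)
  (delta_gt0 : forall k, (0 < delta k)%N)
  (delta_unif : forall k (e : hedge (D k)), hdeg e = delta k)
  (delta_bounded : (fun k => (delta k)%:R : R) =O_\oo (fun=> 1 : R))
  (moment : (fun k => degE (D k) R (2 * delta k)) =o_\oo
            (fun k => (nvert (D k))%:R : R))
  (large_deg : exists2 c : R, 0 < c &
     cvgn (fun k => degP_ge (D k) R (2 * delta k)) /\
     c <= limn (fun k => degP_ge (D k) R (2 * delta k))) :
  exists2 eps : nat -> R, eps @ \oo --> (0 : R) &
    \forall k \near \oo,
      expected_multi_hyperedges (D k) R =
        ((delta k).-1)`!%:R / (2 * (delta k)%:R)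
        * ((nvert (D k))%:R * degE (D k) R 1) ^+ 2
        * ((degE (D k) R 2 - degE (D k) R 1)
           / ((nvert (D k))%:R * degE (D k) R 1 ^+ 2)) ^+ delta k
        * (1 + eps k).
Proof.
pose N i : R := #|stub (D i)|%:R.
pose S i : R := #|coincident_pairs (@vertex_of (D i))|%:R.
pose n i : R := (nvert (D i))%:R.
pose u i : R := (2 * delta i)%:R / N i.
pose w i : R := ((delta i).-1 * max_pairs_at (D i))%:R / S i.
have [K le_K] : exists K : nat, \forall i \near \oo, (delta i <= K)%N.
  have /eqOP/pinfty_ex_gt0[b b_gt0 le_b] := delta_bounded.
  exists (Num.bound b); near=> i.
  have : (delta i)%:R <= b.
    by near: i; apply: filterS le_b => i; rewrite !normr1 mulr1 normr_nat.
  by move=> /le_lt_trans/(_ (archi_boundP (ltW b_gt0))); rewrite ltr_nat => /ltnW.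
have n_ge (b : R) : \forall i \near \oo, b <= n i.
  by move/(cvgrnyP (R := R))/cvgryPge: n_infty; apply.
(* The limit being at least c, the proportion of vertices of degree at least
   2 delta eventually exceeds c / 2. *)
have [c c_gt0 le_c] : exists2 c : R, 0 < c & \forall i \near \oo,
    c * n i <= #|[set v : vert (D i) | (2 * delta i <= vdeg v)%N]%SET|%:R.
  case: large_deg => c c_gt0 [cv le_c]; exists (c / 2); first by rewrite divr_gt0.
  have lt_c : c / 2 < limn (fun k => degP_ge (D k) R (2 * delta k)).
    by apply: lt_le_trans le_c; lra.
  near=> i; have n_gt0 : 0 < n i by apply: lt_le_trans ltr01 _; near: i.
  rewrite -ler_pdivlMr // ltW //.
  have : c / 2 < degP_ge (D i) R (2 * delta i) by near: i; apply: cvgr_gt lt_c.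
  by rewrite /degP_ge /unifP finset.setTI cardsT.
have le_cN : \forall i \near \oo, c * n i <= N i.
  apply: filterS le_c => i /le_trans; apply; rewrite ler_nat.
  by apply: card_large_le_stub; rewrite muln_gt0 delta_gt0.
have le_cS : \forall i \near \oo, c * n i <= S i.
  apply: filterS le_c => i /le_trans; apply; rewrite ler_nat.
  by apply: card_large_le_pairs; have := delta_gt0 i; lia.
have u0 : u @ \oo --> (0 : R).
  apply/cvgr0Pnorm_le => e e_gt0; near=> i.
  have N_gt0 : 0 < N i.
    apply: (@lt_le_trans _ _ (c * n i)); last by near: i.
    by rewrite mulr_gt0 // (lt_le_trans ltr01) //; near: i.
  rewrite ger0_norm ?divr_ge0 // ler_pdivrMr //.
  have le_cNi : c * n i <= N i by near: i.
  apply: le_trans (ler_wpM2l (ltW e_gt0) le_cNi).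
  have : (2 * K)%:R / (e * c) <= n i by near: i; apply: n_ge.
  rewrite ler_pdivrMr ?mulr_gt0 // mulrC -mulrA; apply: le_trans.
  by rewrite ler_nat leq_mul2l; near: i.
have w0 : w @ \oo --> (0 : R).
  apply/cvgr0Pnorm_le => e e_gt0.
  (* If E[d_U^(2 delta)] <= a n, then the square of the numerator of w is at
     most (K + 1)^2 a n^2 = (e c n)^2 <= (e S)^2. *)
  pose a := (e * c / K.+1%:R) ^+ 2.
  have a_gt0 : 0 < a by rewrite exprn_gt0 // divr_gt0 ?mulr_gt0.
  near=> i.
  have n_gt0 : 0 < n i by rewrite (lt_le_trans ltr01) //; near: i.
  have le_cSi : c * n i <= S i by near: i.
  have S_gt0 : 0 < S i by apply: lt_le_trans le_cSi; rewrite mulr_gt0.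
  rewrite ger0_norm ?divr_ge0 // ler_pdivrMr //.
  rewrite -(@ler_pXn2r _ 2) ?nnegrE ?mulr_ge0 ?(ltW e_gt0) //.
  have le_a : degE (D i) R (2 * delta i) <= a * n i.
    apply: le_trans (ler_norm _) _; rewrite -(ger0_norm (ltW n_gt0)).
    by near: i; move/eqoP: moment; apply.
  have le_Ki : (delta i <= K)%N by near: i.
  apply: (@le_trans _ _ (K.+1%:R ^+ 2 * (n i * (a * n i)))); last first.
    have -> : K.+1%:R ^+ 2 * (n i * (a * n i)) = (e * (c * n i)) ^+ 2.
      have : K.+1%:R != 0 :> R by rewrite pnatr_eq0.
      by rewrite /a; move: (K.+1%:R) => q q_neq0; field.
    by rewrite ler_pXn2r ?nnegrE ?mulr_ge0 ?ler_wpM2l // ltW // ?mulr_gt0.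
  have := max_pairs_at_sqr_le (D i) (delta_gt0 i).
  rewrite -(ler_nat R) natrX [leRHS]natrM natrX -nvert_degE -?(ltr0n R) //.
  move=> /le_trans; apply.
  apply: ler_pM; rewrite ?exprn_ge0 ?mulr_ge0 ?ler_pM2l //.
  - by rewrite sumr_ge0 // => v _; rewrite exprn_ge0.
  by rewrite ler_pXn2r ?nnegrE // ler_nat leqW.
have near_pos : \forall i \near \oo, [/\ 0 < N i & 0 < S i].
  near=> i; have cn_gt0 : 0 < c * n i.
    by rewrite mulr_gt0 // (lt_le_trans ltr01) //; near: i.
  by split; apply: lt_le_trans cn_gt0 _; near: i.
have near_bounds : \forall i \near \oo, [/\ (2 * delta i < #|stub (D i)|)%N,
    (0 < #|coincident_pairs (@vertex_of (D i))|)%N &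
  (1 - u i) * (1 - w i) ^+ K <= multi_hyperedge_ratio R (D i) (delta i)
     <= (1 - u i)^-1 ^+ (2 * K)].
  near=> i; have [N_gt0 S_gt0] : [/\ 0 < N i & 0 < S i] by near: i.
  have : `|u i| < 1 by near: i; apply: cvgr0_norm_lt.
  have : `|w i| < 1 by near: i; apply: cvgr0_norm_lt.
  rewrite !ger0_norm ?divr_ge0 // !ltr_pdivrMr // !mul1r !ltr_nat.
  rewrite ltr0n in S_gt0 => lt_MS lt_2N; split=> //.
  apply: multi_hyperedge_ratio_bounds => //; last exact: ltnW.
  by rewrite delta_gt0; near: i.
exists (fun i => multi_hyperedge_ratio R (D i) (delta i) - 1); last first.
  near=> i => /=.
  have [lt_2N S_gt0 _] : [/\ (2 * delta i < #|stub (D i)|)%N,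
    (0 < #|coincident_pairs (@vertex_of (D i))|)%N &
    (1 - u i) * (1 - w i) ^+ K <= multi_hyperedge_ratio R (D i) (delta i)
     <= (1 - u i)^-1 ^+ (2 * K)] by near: i.
  by rewrite [1 + _]addrC subrK (@expected_multi_hyperedgesE _ _ (delta i)) // ltnW.
have u1 : (fun i => 1 - u i) @ \oo --> (1 : R).
  by have := cvgB (cvg_cst (1 : R)) u0; rewrite subr0; apply.
have w1 : (fun i => 1 - w i) @ \oo --> (1 : R).
  by have := cvgB (cvg_cst (1 : R)) w0; rewrite subr0; apply.
have cvg_expr m (f : nat -> R) :
    f @ \oo --> (1 : R) -> (fun i => f i ^+ m) @ \oo --> (1 : R).
  move=> f1; have := cvg_comp _ _ f1 (@exprn_continuous R m 1).
  by rewrite expr1n; apply.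
apply/subr_cvg0.
apply: (@squeeze_cvgr _ _ _ _ (fun i => (1 - u i) * (1 - w i) ^+ K)
                      (fun i => (1 - u i)^-1 ^+ (2 * K))).
- by apply: filterS near_bounds => i [].
- by have := cvgM u1 (cvg_expr K _ w1); rewrite mulr1; apply.
by apply: cvg_expr; have := cvgV (oner_neq0 R) u1; rewrite invr1; apply.
Unshelve. all: by end_near.
Qed.
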